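(* Let $n\geq 2$ and let $\varphi\in C[0,1]$ be strictly positive, with $m:=\min_{x\in[0,1]}\varphi(x)$. Suppose that the polynomial $$Q_{n-1}(x)=B_{n-1}\varphi(x)=\sum_{k=0}^{n-1}\varphi\left(\frac{k}{n-1}\right)\binom{n-1}{k}x^k(1-x)^{n-1-k}$$ satisfies property (W), and let $R_n$ be the rational Bernstein operator associated with $Q_{n-1}$. Then for all $f\in C[0,1]$ and all $x\in[0,1]$, $$\left|R_nf(x)-f(x)\right|\leq\left(1+\sqrt{x(1-x)}\right)\omega_1\left(f,\ \frac{1}{\sqrt n}+\frac{1}{2m}\,\omega_1\left(\varphi,\frac{1}{n-1}\right)\right).$$
   Context: $C[0,1]$ is the space of continuous real-valued functions on $[0,1]$. The first modulus of continuity of $g\in C[0,1]$ is $\omega_1(g,h)=\sup\{|g(x)-g(y)|: x,y\in[0,1],\ |x-y|\leq h\}$, $h>0$. Write $Q_{n-1}(x)=\sum_{k=0}^{n-1}\gamma_{n-1,k}\,x^k(1-x)^{n-1-k}$ with $\gamma_{n-1,k}=w_{n-1,k}\binom{n-1}{k}$ (here $w_{n-1,k}=\varphi(k/(n-1))>0$). Property (W) means: $\frac{w_{n-1,k-1}w_{n-1,k+1}}{w_{n-1,k}^2}<\frac{k+1}{k}\cdot\frac{n-k}{n-k-1}$ for $k=1,\dots,n-2$ (equivalently, $\gamma_{n-1,k-1}/\gamma_{n-1,k}$ is strictly increasing in $k=1,\dots,n-1$). Convention: $\gamma_{n-1,-1}=\gamma_{n-1,n}=0$. The nodes are $x_{n,k}=\frac{\gamma_{n-1,k-1}}{\gamma_{n-1,k}+\gamma_{n-1,k-1}}$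 for $k=0,\dots,n$; when $w_{n-1,k}>0$ for all $k=0,\dots,n-1$ and property (W) holds, $0=x_{n,0}<x_{n,1}<\dots<x_{n,n}=1$. The rational Bernstein operator associated with $Q_{n-1}$ is $$R_nf(x)=\sum_{k=0}^{n}f(x_{n,k})\,(\gamma_{n-1,k}+\gamma_{n-1,k-1})\,\frac{x^k(1-x)^{n-k}}{Q_{n-1}(x)},\qquad f\in C[0,1],$$ which reproduces the functions $1$ and $x$. *)

(* Defs.v *)
From HB Require Import structures.
From mathcomp Require Import all_boot all_order all_algebra.
From mathcomp Require Import all_classical all_reals all_analysis.
Set Implicit Arguments.
Unset Strict Implicit.
Unset Printing Implicit Defensive.
Import Order.TTheory GRing.Theory Num.Theory.
Import numFieldNormedType.Exports.
Local Open Scope classical_set_scope.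
Local Open Scope ring_scope.

Definition omega1 (R : realType) (g : R -> R) (h : R) : R :=
  sup [set d : R | exists x y : R,
    [/\ x \in `[0, 1], y \in `[0, 1], `|x - y| <= h & d = `|g x - g y|]].

Definition bernstein (R : realType) (N : nat) (g : R -> R) (x : R) : R :=
  \sum_(k < N.+1) g (k%:R / N%:R) * 'C(N, k)%:R * x ^+ k * (1 - x) ^+ (N - k).

Definition bernstein_weight (R : realType) (N : nat) (g : R -> R) (k : nat) : R :=
  g (k%:R / N%:R).

(** [gamma N w k] vanishes for [k = N.+1] because ['C(N, N.+1) = 0];
    [gamma_pred N w k] is the coefficient of index [k - 1], with the convention
    that the coefficient of index [-1] is [0]. *)
Definition gamma (R : realType) (N : nat) (w : nat -> R) (k : nat) : R :=
  w k * 'C(N, k)%:R.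

Definition gamma_pred (R : realType) (N : nat) (w : nat -> R) (k : nat) : R :=
  if k is j.+1 then gamma N w j else 0.

Definition weighted_poly (R : realType) (N : nat) (w : nat -> R) (x : R) : R :=
  \sum_(k < N.+1) gamma N w k * x ^+ k * (1 - x) ^+ (N - k).

Lemma weighted_poly_bernstein (R : realType) (N : nat) (g : R -> R) :
  weighted_poly N (bernstein_weight N g) = bernstein N g.
Proof. by []. Qed.

(** [w] gives the weights of a polynomial of degree [n - 1]; the fractions on
    the right are computed in [R], where [1 <= k <= n - 2] makes every
    denominator positive. *)
Definition propertyW (R : realType) (n : nat) (w : nat -> R) : Prop :=
  forall k : nat, (1 <= k <= n - 2)%N ->
    w k.-1 * w k.+1 / w k ^+ 2 <
      (k%:R + 1) / k%:R * ((n%:R - k%:R) / (n%:R - k%:R - 1)).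

Definition node (R : realType) (n : nat) (w : nat -> R) (k : nat) : R :=
  gamma_pred n.-1 w k / (gamma n.-1 w k + gamma_pred n.-1 w k).

Definition rational_bernstein (R : realType) (n : nat) (w : nat -> R)
    (f : R -> R) (x : R) : R :=
  \sum_(k < n.+1) f (node n w k) * (gamma n.-1 w k + gamma_pred n.-1 w k) *
    (x ^+ k * (1 - x) ^+ (n - k) / weighted_poly n.-1 w x).

(* Main.v *)
Require Import Defs.
From HB Require Import structures.
From mathcomp Require Import all_boot all_order all_algebra.
From mathcomp Require Import all_classical all_reals all_analysis.
From mathcomp Require Import ring lra.
Set Implicit Arguments.
Unset Strict Implicit.
Unset Printing Implicit Defensive.
Import Order.TTheory GRing.Theory Num.Theory.
Import numFieldNormedType.Exports.
Local Open Scope classical_set_scope.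
Local Open Scope ring_scope.

(** The operator averages [f] over the nodes [s_k] with nonnegative weights of
    sum [1]. Since [|f(s) - f(x)| <= (1 + |s - x| / h) omega1 f h]
    ([dist_le_omega1]), it suffices to bound the mean of [|s_k - x|] by
    [sqrt(x(1-x)) h] with [h = 1 / sqrt n + om / (2m)] and
    [om = omega1 phi (1/(n-1))]. By Cauchy-Schwarz ([mean_abs_le_sqrt]) this
    follows once the mean of [(s_k - x)^2] is at most [x (1-x) h^2].

    That second moment is computed exactly. Let [q_k] be the probability
    proportional to [w_k C(n-1,k) x^k (1-x)^(n-1-k)], so that the normalising
    constant is [Q_{n-1}(x)]. Then ([sum_node_deviation_sqr])
<<
      mean of (s_k - x)^2  =  x (1-x) sum_k (s_{k+1} - s_k) q_k
>>
    and a summation by parts gives ([weighted_poly_node_gap])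
<<
      sum_k (s_{k+1} - s_k) q_k
        = 1/n + (n-1)/(n Q) sum_j (w_j - w_{j+1}) (s_{j+1} - x) b_j(x),
>>
    where the [b_j] are the Bernstein basis polynomials of degree [n-2].
    Constant weights leave only the [1/n] of the classical operator, and the
    correction is small because increments of [w] are multiplied by distances
    to [x]. Indeed [|w_j - w_{j+1}| <= om], the node [s_{j+1}] lies within
    [om / (4m)] of [(j+1)/n] ([node_dist_equispaced_le]), the mean of
    [|(j+1)/n - x|] is at most [1 / sqrt n]
    ([weighted_poly_shifted_moment2]), and [Q >= m]. The sum is thus at most
    [1/n + om / (m sqrt n) + om^2 / (4 m^2) = h^2] ([node_gap_le]). *)

(** * Bernstein polynomials with arbitrary coefficients *)

(** The term with [gamma N w k] carries a spare factor [1 - x], the one with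
    [gamma_pred N w k] a spare factor [x]; this converts sums over the nodes,
    of degree [N.+1], into polynomials of degree [N]. *)
Lemma sum_gamma_split (R : realType) (N : nat) (w a b : nat -> R) (x : R) :
  \sum_(k < N.+2) (a k * gamma N w k + b k * gamma_pred N w k) *
      (x ^+ k * (1 - x) ^+ (N.+1 - k)) =
  (1 - x) * weighted_poly N (fun k => a k * w k) x
    + x * weighted_poly N (fun k => b k.+1 * w k) x.
Proof.
under eq_bigr do rewrite mulrDl.
rewrite big_split /=; congr (_ + _).
  rewrite big_ord_recr /= {2}/gamma bin_small // !mulr0 mul0r addr0.
  rewrite /weighted_poly mulr_sumr; apply: eq_bigr => k _.
  by rewrite subSn ?leq_ord // exprS /gamma; ring.
rewrite big_ord_recl /= mulr0 mul0r add0r.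
rewrite /weighted_poly mulr_sumr; apply: eq_bigr => k _.
by rewrite /bump leq0n add1n /= subSS exprS /gamma; ring.
Qed.

(** De Casteljau's recurrence: Pascal's rule says that the coefficients
    [gamma N 1 k + gamma_pred N 1 k] are the binomials ['C(N.+1, k)], so this
    is [sum_gamma_split] for the constant weight [1]. *)
Lemma weighted_polyS (R : realType) (N : nat) (w : nat -> R) (x : R) :
  weighted_poly N.+1 w x =
  (1 - x) * weighted_poly N w x + x * weighted_poly N (w \o S) x.
Proof.
have := @sum_gamma_split R N (fun=> 1) w w x.
rewrite /weighted_poly /gamma /= => e.
transitivity (\sum_(k < N.+2) (w k * (1 * 'C(N, k)%:R) +
  w k * gamma_pred N (fun=> 1) k) * (x ^+ k * (1 - x) ^+ (N.+1 - k))).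
  apply: eq_bigr => -[[|k] ltk] _ /=; first by rewrite !bin0; ring.
  by rewrite /gamma binS natrD; ring.
rewrite e; congr (_ * _ + _ * _); apply: eq_bigr => k _; ring.
Qed.

Lemma weighted_poly1 (R : realType) (N : nat) (x : R) :
  weighted_poly N (fun=> 1) x = 1.
Proof.
elim: N => [|N IH]; last by rewrite weighted_polyS (_ : _ \o _ = fun=> 1) // IH; ring.
by rewrite /weighted_poly big_ord1 /gamma bin0 subnn !expr0; ring.
Qed.

(** Second moment of a binomial variable about an arbitrary point [a]. Keeping
    [a] free closes the induction: the shift in [weighted_polyS] replaces [a]
    by [a - 1]. *)
Lemma weighted_poly_moment2 (R : realType) (N : nat) (a x : R) :
  weighted_poly N (fun k => (k%:R - a) ^+ 2) x =
  N%:R * x * (1 - x) + (N%:R * x - a) ^+ 2.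
Proof.
elim: N a => [a|N IH a].
  by rewrite /weighted_poly big_ord1 /gamma bin0 subnn !expr0 /=; ring.
have eS : (fun k : nat => (k%:R - a) ^+ 2) \o S = fun k => (k%:R - (a - 1)) ^+ 2.
  by apply/funext => k /=; rewrite -natr1; ring.
rewrite weighted_polyS eS !IH -natr1; ring.
Qed.

Lemma ler_weighted_poly (R : realType) (N : nat) (v w : nat -> R) (x : R) :
  0 <= x <= 1 -> (forall k, (k <= N)%N -> v k <= w k) ->
  weighted_poly N v x <= weighted_poly N w x.
Proof.
move=> /andP[x0 x1] vw; apply: ler_sum => k _; rewrite /gamma.
rewrite !ler_wpM2r ?exprn_ge0 ?subr_ge0 // vw //; exact: leq_ord.
Qed.

Lemma weighted_polyD (R : realType) (N : nat) (v w : nat -> R) (x : R) :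
  weighted_poly N (fun k => v k + w k) x =
  weighted_poly N v x + weighted_poly N w x.
Proof.
by rewrite -big_split; apply: eq_bigr => k _; rewrite /gamma /=; ring.
Qed.

Lemma weighted_polyZ (R : realType) (N : nat) (c : R) (w : nat -> R) (x : R) :
  weighted_poly N (fun k => c * w k) x = c * weighted_poly N w x.
Proof.
by rewrite mulr_sumr; apply: eq_bigr => k _; rewrite /gamma; ring.
Qed.

Lemma eq_weighted_poly (R : realType) (N : nat) (v w : nat -> R) (x : R) :
  (forall k, (k <= N)%N -> v k = w k) ->
  weighted_poly N v x = weighted_poly N w x.
Proof.
by move=> vw; apply: eq_bigr => k _; rewrite /gamma vw // leq_ord.
Qed.

Lemma weighted_poly_ge (R : realType) (N : nat) (w : nat -> R) (m x : R) :
  0 <= x <= 1 -> (forall k, (k <= N)%N -> m <= w k) -> m <= weighted_poly N w x.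
Proof.
move=> x01 mw; have <- : weighted_poly N (fun=> m * 1) x = m.
  by rewrite (weighted_polyZ N m (fun=> 1)) weighted_poly1 mulr1.
by apply: ler_weighted_poly => // k kN; rewrite mulr1 mw.
Qed.

(** The weight [k] is absorbed by [k C(N+1, k) = (N+1) C(N, k-1)], and in
    [weighted_poly_absorb_down] the weight [N+1-k] by
    [(N+1-k) C(N+1, k) = (N+1) C(N, k)]. *)
Lemma weighted_poly_absorb_up (R : realType) (N : nat) (c : nat -> R) (x : R) :
  weighted_poly N.+1 (fun k => k%:R * c k) x =
  N.+1%:R * x * weighted_poly N (c \o S) x.
Proof.
rewrite /weighted_poly big_ord_recl /= {1}/gamma !mul0r add0r.
rewrite mulr_sumr; apply: eq_bigr => k _.
rewrite /bump leq0n add1n subSS exprS /gamma /=.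
have := congr1 (fun i => i%:R : R) (mul_bin_diag N.+1 k); rewrite !natrM /= => e.
transitivity (c k.+1 * (k.+1%:R * 'C(N.+1, k.+1)%:R) * (x * x ^+ k) * (1 - x) ^+ (N - k)).
  ring.
by rewrite -e; ring.
Qed.

Lemma weighted_poly_absorb_down (R : realType) (N : nat) (c : nat -> R) (x : R) :
  weighted_poly N.+1 (fun k => (N.+1%:R - k%:R) * c k) x =
  N.+1%:R * (1 - x) * weighted_poly N c x.
Proof.
rewrite /weighted_poly big_ord_recr /= {2}/gamma subrr !mul0r addr0.
rewrite mulr_sumr; apply: eq_bigr => k _ /=.
rewrite subSn ?leq_ord // exprS /gamma.
have := congr1 (fun i => i%:R : R) (mul_bin_down N.+1 k).
rewrite !natrM natrB ?(leq_trans (leq_ord k)) //= => e.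
transitivity (c k * ((N.+1%:R - k%:R) * 'C(N.+1, k)%:R) * x ^+ k *
   ((1 - x) * (1 - x) ^+ (N - k))).
  ring.
by rewrite -e; ring.
Qed.

(** * First and second absolute moments *)

(** The variance of [|g|] is nonnegative. *)
Lemma mean_abs_le_sqrt (R : realType) (N : nat) (p g : 'I_N -> R) :
  (forall k, 0 <= p k) -> \sum_k p k = 1 ->
  \sum_k p k * `|g k| <= Num.sqrt (\sum_k p k * g k ^+ 2).
Proof.
move=> p0 p1; have [a aE] : exists a, a = \sum_k p k * `|g k| by eexists.
rewrite -aE; have a0 : 0 <= a by rewrite aE; apply: sumr_ge0 => k _; rewrite mulr_ge0.
rewrite -[leLHS]ger0_norm // -sqrtr_sqr ler_wsqrtr //.
have : 0 <= \sum_k p k * (`|g k| - a) ^+ 2.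
  by apply: sumr_ge0 => k _; rewrite mulr_ge0 // sqr_ge0.
suff -> : \sum_k p k * (`|g k| - a) ^+ 2 =
    \sum_k p k * g k ^+ 2 - 2 * a * (\sum_k p k * `|g k|) + a ^+ 2 * \sum_k p k.
  by rewrite p1 -aE; lra.
rewrite !mulr_sumr -sumrB -big_split; apply: eq_bigr => k _ /=.
by rewrite -[g k ^+ 2]real_normK ?num_real //; ring.
Qed.

Lemma weighted_poly_abs_le_sqrt (R : realType) (N : nat) (g : nat -> R) (x : R) :
  0 <= x <= 1 ->
  weighted_poly N (fun k => `|g k|) x <=
  Num.sqrt (weighted_poly N (fun k => g k ^+ 2) x).
Proof.
move=> /andP[x0 x1].
pose p (k : 'I_N.+1) := gamma N (fun=> 1) k * x ^+ k * (1 - x) ^+ (N - k).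
have p0 k : 0 <= p k.
  by rewrite /p /gamma mul1r !mulr_ge0 ?exprn_ge0 ?subr_ge0.
have := @mean_abs_le_sqrt R N.+1 p g p0 (weighted_poly1 N x).
rewrite /weighted_poly; congr (_ <= Num.sqrt _);
  by apply: eq_bigr => k _; rewrite /p /gamma; ring.
Qed.

(** * The modulus of continuity *)

(** Continuity on the compact interval bounds the set whose supremum defines
    [omega1]; for an unbounded set that supremum would be meaningless. *)
Lemma omega1_ge (R : realType) (g : R -> R) (h x y : R) :
  {within `[0, 1], continuous g} -> x \in `[0, 1] -> y \in `[0, 1] ->
  `|x - y| <= h -> `|g x - g y| <= omega1 g h.
Proof.
move=> gc x01 y01 xyh; apply: ub_le_sup; last by exists x, y.
have [c _ hc] := EVT_max ler01 gc; have [d _ hd] := EVT_min ler01 gc.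
exists (g c - g d) => _ [u [v [u01 v01 _ ->]]].
rewrite ler_norml.
have := hc _ u01; have := hc _ v01; have := hd _ u01; have := hd _ v01.
lra.
Qed.

(** A segment of length at most [k h] is cut into [k] equal pieces, along which
    the triangle inequality is applied. *)
Lemma omega1_ge_natmul (R : realType) (g : R -> R) (h : R) (k : nat) (x y : R) :
  {within `[0, 1], continuous g} -> x \in `[0, 1] -> y \in `[0, 1] ->
  `|x - y| <= k%:R * h -> `|g x - g y| <= k%:R * omega1 g h.
Proof.
move=> gc; elim: k x y => [|k IH] x y x01 y01 xyh.
  have : `|x - y| <= 0 by rewrite mul0r in xyh.
  by rewrite normr_le0 subr_eq0 => /eqP ->; rewrite subrr normr0 mul0r.
have k1 : 0 < k.+1%:R :> R by rewrite ltr0n.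
have k0 : 0 <= k%:R :> R by rewrite ler0n.
pose t : R := k%:R / k.+1%:R.
have t0 : 0 <= t by rewrite divr_ge0 // ltW.
have t1 : t <= 1 by rewrite ler_pdivrMr // mul1r -natr1; lra.
have tk : t * k.+1%:R = k%:R by rewrite mulfVK // gt_eqF.
pose z := y + t * (x - y).
have z01 : z \in `[0, 1].
  move: x01 y01; rewrite !in_itv /= => /andP[? ?] /andP[? ?].
  by apply/andP; rewrite /z; split; nra.
have zy : `|z - y| <= k%:R * h.
  rewrite /z addrAC subrr add0r normrM ger0_norm //.
  by rewrite -tk -mulrA ler_wpM2l.
have xz : `|x - z| <= h.
  have -> : x - z = (1 - t) * (x - y) by rewrite /z; ring.
  rewrite normrM ger0_norm ?subr_ge0 //.
  rewrite (le_trans (ler_wpM2l _ xyh)) ?subr_ge0 //.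
  by rewrite mulrA mulrBl tk mul1r -natr1 addrAC subrr add0r mul1r.
have -> : g x - g y = (g x - g z) + (g z - g y) by ring.
rewrite (le_trans (ler_normD _ _)) // -natr1 mulrDl mul1r addrC lerD //.
  exact: IH.
exact: omega1_ge.
Qed.

Lemma omega1_ge0 (R : realType) (g : R -> R) (h : R) :
  {within `[0, 1], continuous g} -> 0 <= h -> 0 <= omega1 g h.
Proof.
move=> gc h0; have z01 : (0 : R) \in `[0, 1] by rewrite in_itv /= lexx ler01.
have := @omega1_ge R g h 0 0 gc z01 z01; rewrite !subrr normr0; exact.
Qed.

(** The previous bound with [floor(|x - y| / h) + 1] pieces. *)
Lemma dist_le_omega1 (R : realType) (g : R -> R) (h x y : R) :
  {within `[0, 1], continuous g} -> 0 < h -> x \in `[0, 1] -> y \in `[0, 1] ->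
  `|g x - g y| <= (1 + `|x - y| / h) * omega1 g h.
Proof.
move=> gc h0 x01 y01; set q := `|x - y| / h.
have q0 : 0 <= q by rewrite divr_ge0 // ltW.
have /andP[lo hi] := Num.Theory.truncn_itv q0.
have le1 : `|x - y| <= (Num.truncn q).+1%:R * h by rewrite -ler_pdivrMr // ltW.
apply: (le_trans (omega1_ge_natmul gc x01 y01 le1)).
rewrite ler_wpM2r ?omega1_ge0 ?(ltW h0) // -natr1; lra.
Qed.

(** * The nodes *)

Lemma gamma_sum_gt0 (R : realType) (N : nat) (w : nat -> R) (k : nat) :
  (forall i, (i <= N)%N -> 0 < w i) -> (k <= N.+1)%N ->
  0 < gamma N w k + gamma_pred N w k.
Proof.
move=> w0; case: k => [|k] kN /=.
  by rewrite /gamma bin0 mulr1 addr0 w0.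
apply: ltr_wpDl; last by rewrite /gamma mulr_gt0 ?w0 // ltr0n bin_gt0.
rewrite /gamma; case: (leqP k.+1 N) => kN1.
  by rewrite mulr_ge0 // ltW // w0.
by rewrite bin_small // mulr0.
Qed.

Lemma node_mul_gamma_sum (R : realType) (N : nat) (w : nat -> R) (k : nat) :
  (forall i, (i <= N)%N -> 0 < w i) -> (k <= N.+1)%N ->
  node N.+1 w k * (gamma N w k + gamma_pred N w k) = gamma_pred N w k.
Proof. by move=> w0 kN; rewrite /node mulfVK // gt_eqF // gamma_sum_gt0. Qed.

(** The operator reproduces constants: its weights are the coefficients of
    [Q_{n-1}] after degree elevation. *)
Lemma sum_gamma_elevation (R : realType) (N : nat) (w : nat -> R) (x : R) :
  \sum_(k < N.+2) (gamma N w k + gamma_pred N w k) *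
      (x ^+ k * (1 - x) ^+ (N.+1 - k)) = weighted_poly N w x.
Proof.
transitivity (\sum_(k < N.+2) (1 * gamma N w k + 1 * gamma_pred N w k) *
      (x ^+ k * (1 - x) ^+ (N.+1 - k))).
  by apply: eq_bigr => k _; rewrite !mul1r.
rewrite (sum_gamma_split N w (fun=> 1) (fun=> 1)) -mulrDl subrK mul1r.
by apply: eq_weighted_poly => k _; rewrite mul1r.
Qed.

Lemma node_itv (R : realType) (N : nat) (w : nat -> R) (k : nat) :
  (forall i, (i <= N)%N -> 0 < w i) -> (k <= N.+1)%N ->
  node N.+1 w k \in `[0, 1].
Proof.
move=> w0 kN; have D0 := gamma_sum_gt0 w0 kN; rewrite in_itv /= /node.
have g0 : 0 <= gamma N w k.
  rewrite /gamma; case: (leqP k N) => kN1; first by rewrite mulr_ge0 // ltW // w0.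
  by rewrite bin_small // mulr0.
have p0 : 0 <= gamma_pred N w k.
  by case: k kN {D0 g0} => //= k kN; rewrite /gamma mulr_ge0 // ltW // w0.
by rewrite divr_ge0 ?addr_ge0 //= ler_pdivrMr // mul1r lerDr.
Qed.

(** The definition of the node, cleared of denominators and divided by the
    binomial factor, so that only the weights remain. The coefficients [0] of
    [w k.-1] at [k = 0] and of [w k] at [k = N.+1] make the identity hold at
    both ends, where the index would leave the range [0 .. N]. *)
Lemma node_balance (R : realType) (N : nat) (w : nat -> R) (k : nat) :
  (forall i, (i <= N)%N -> 0 < w i) -> (k <= N.+1)%N ->
  node N.+1 w k * (k%:R * w k.-1 + (N.+1%:R - k%:R) * w k) = k%:R * w k.-1.
Proof.
move=> w0; case: k => [|k] kN; first by rewrite /node /= !mul0r.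
have /= e := node_mul_gamma_sum w0 kN; move: e.
set s := node _ _ _; rewrite /gamma => e.
have C0 : 'C(N, k)%:R != 0 :> R by rewrite pnatr_eq0 -lt0n bin_gt0.
apply: (mulIf C0) => /=.
have := congr1 (fun i => i%:R : R) (mul_bin_left N k).
rewrite !natrM natrB // => e2.
have -> : N.+1%:R - k.+1%:R = N%:R - k%:R :> R by rewrite -!natr1; ring.
transitivity (k.+1%:R * (s * (w k.+1 * 'C(N, k.+1)%:R + w k * 'C(N, k)%:R))).
  transitivity (s * (k.+1%:R * w k * 'C(N, k)%:R +
    w k.+1 * ((N%:R - k%:R) * 'C(N, k)%:R))); first by ring.
  by rewrite -e2; ring.
by rewrite e; ring.
Qed.

(** * The second moment of the operator *)

(** One of the two factors [s_k - x] is cleared by the definition of the node: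
    [(s_k - x) (gamma_k + gamma_{k-1}) = (1-x) gamma_{k-1} - x gamma_k].
    Splitting the sum and shifting the index in the first part leaves the
    factor [x (1-x)] and the gaps between consecutive nodes. *)
Lemma sum_node_deviation_sqr (R : realType) (N : nat) (w : nat -> R) (x : R) :
  (forall i, (i <= N)%N -> 0 < w i) ->
  \sum_(k < N.+2) (gamma N w k + gamma_pred N w k) *
     (x ^+ k * (1 - x) ^+ (N.+1 - k)) * (node N.+1 w k - x) ^+ 2 =
  x * (1 - x) *
    weighted_poly N (fun k => (node N.+1 w k.+1 - node N.+1 w k) * w k) x.
Proof.
move=> w0; set s := node N.+1 w.
transitivity (\sum_(k < N.+2) (- x * (s k - x) * gamma N w k +
    (1 - x) * (s k - x) * gamma_pred N w k) * (x ^+ k * (1 - x) ^+ (N.+1 - k))).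
  apply: eq_bigr => k _.
  have e := node_mul_gamma_sum w0 (leq_ord k); rewrite -/s in e.
  set B := x ^+ k * _.
  transitivity ((s k * (gamma N w k + gamma_pred N w k)
    - x * (gamma N w k + gamma_pred N w k)) * (s k - x) * B); first by ring.
  by rewrite e; ring.
rewrite (sum_gamma_split N w (fun k => - x * (s k - x))
  (fun k => (1 - x) * (s k - x))) -!weighted_polyZ -weighted_polyD.
by apply: eq_weighted_poly => k _; ring.
Qed.

(** Equispaced nodes would have all gaps equal to [1/n], where [n = N.+2]; the
    rest is proportional to the increments of [w] and to the distance from the
    nodes to [x]. Multiplying the gap by [n w_k] and using [node_balance] at
    [k] and [k.+1] turns it into a term free of denominators plus terms with
    factors [N.+1 - k] and [k], which are absorbed into the binomials. *)
Lemma weighted_poly_node_gap (R : realType) (N : nat) (w : nat -> R) (x : R) :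
  (forall i, (i <= N.+1)%N -> 0 < w i) ->
  N.+2%:R * weighted_poly N.+1
     (fun k => (node N.+2 w k.+1 - node N.+2 w k) * w k) x =
  weighted_poly N.+1 w x + N.+1%:R *
    weighted_poly N (fun j => (w j - w j.+1) * (node N.+2 w j.+1 - x)) x.
Proof.
move=> w0; set s := node N.+2 w.
have bal k (kN : (k <= N.+2)%N) := node_balance w0 kN; rewrite -/s in bal.
transitivity (weighted_poly N.+1 (fun k => w k
    + (N.+1%:R - k%:R) * ((w k - w k.+1) * s k.+1)
    + k%:R * ((w k.-1 - w k) * (s k - 1))) x).
  rewrite -weighted_polyZ; apply: eq_weighted_poly => k kN.
  have := bal _ (leqW kN); have /= := bal k.+1 kN.
  rewrite -[N.+2%:R]natr1 -[k.+1%:R]natr1; set a : R := N.+1%:R; set c : R := k%:R.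
  by lra.
rewrite !weighted_polyD weighted_poly_absorb_up
  (weighted_poly_absorb_down N (fun k => (w k - w k.+1) * s k.+1)) /=.
rewrite -addrA -!mulrA -mulrDr; congr (_ + _ * _).
rewrite -!weighted_polyZ -weighted_polyD.
by apply: eq_weighted_poly => k _ /=; ring.
Qed.

(** By [node_balance], with [n = N.+2], [a = k.+1] and [D = a w_k + (n-a) w_{k+1}],
    the deviation is [a (n-a) (w_k - w_{k+1}) / (n D)]; here
    [a (n-a) <= n^2/4] and [D >= n m]. *)
Lemma node_dist_equispaced_le (R : realType) (N : nat) (w : nat -> R) (m om : R) (k : nat) :
  0 < m -> (forall i, (i <= N.+1)%N -> m <= w i) ->
  (forall i, (i <= N)%N -> `|w i - w i.+1| <= om) -> (k <= N)%N ->
  `|node N.+2 w k.+1 - k.+1%:R / N.+2%:R| <= om / (4 * m).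
Proof.
move=> m0 mw wom kN.
have w0 i : (i <= N.+1)%N -> 0 < w i by move=> /mw; apply: lt_le_trans.
have /= := node_balance w0 (leqW kN : (k.+1 <= N.+2)%N).
set s := node _ _ _; set n : R := N.+2%:R; set a : R := k.+1%:R => bal.
have n0 : 0 < n by rewrite ltr0n.
have a0 : 0 <= a by rewrite ler0n.
have an : a <= n by rewrite ler_nat !ltnS leqW.
have ma := mw k (leqW kN); have mb := mw k.+1 kN.
have om0 : 0 <= om by apply: le_trans (wom k kN).
set D := a * w k + (n - a) * w k.+1 in bal.
have Dm : n * m <= D by rewrite /D; nra.
have D0 : 0 < D by apply: lt_le_trans Dm; rewrite mulr_gt0.
have nD0 : 0 < n * D by rewrite mulr_gt0.
rewrite -(ler_pM2r nD0) -{1}(gtr0_norm nD0) -normrM.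
have -> : (s - a / n) * (n * D) = a * (n - a) * (w k - w k.+1).
  transitivity (n * (s * D) - a * D); first by field; rewrite gt_eqF.
  by rewrite bal /D; ring.
rewrite normrM ger0_norm ?mulr_ge0 ?subr_ge0 //.
have -> : om / (4 * m) * (n * D) = n / 4 * om * (D / m).
  by field; rewrite gt_eqF.
have nDm : n <= D / m by rewrite ler_pdivlMr.
apply: (@le_trans _ _ (n / 4 * om * n)); last first.
  by rewrite ler_wpM2l // !mulr_ge0 // ?ltW.
apply: (@le_trans _ _ (a * (n - a) * om)).
  by rewrite ler_wpM2l ?mulr_ge0 ?subr_ge0 // wom.
have : a * (n - a) <= n / 4 * n by have := sqr_ge0 (n - 2 * a); lra.
by move=> /(ler_wpM2r om0); lra.
Qed.

(** With [n = N.+2], the value times [n^2] is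
    [(n-2) x (1-x) + (1-2x)^2], at most [n]. *)
Lemma weighted_poly_shifted_moment2 (R : realType) (N : nat) (x : R) :
  0 <= x <= 1 ->
  weighted_poly N (fun k => (k.+1%:R / N.+2%:R - x) ^+ 2) x <= N.+2%:R^-1.
Proof.
move=> /andP[x0 x1]; set n : R := N.+2%:R.
have n0 : 0 < n by rewrite ltr0n.
have -> : weighted_poly N (fun k => (k.+1%:R / n - x) ^+ 2) x =
    n ^- 2 * weighted_poly N (fun k => (k%:R - (n * x - 1)) ^+ 2) x.
  rewrite -weighted_polyZ; apply: eq_weighted_poly => k _.
  by rewrite -natr1; field; rewrite gt_eqF.
rewrite weighted_poly_moment2.
have nE : n = N%:R + 2 by rewrite /n -!natr1; ring.
have N0 : 0 <= N%:R :> R by rewrite ler0n.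
rewrite -(ler_pM2l (exprn_gt0 2 n0)) mulrA divff ?expf_neq0 ?gt_eqF // mul1r.
rewrite expr2 mulfK ?gt_eqF // nE.
have X0 : 0 <= x * (1 - x) by rewrite mulr_ge0 // subr_ge0.
have X1 : x * (1 - x) <= 1 by nra.
by nra.
Qed.

(** In [weighted_poly_node_gap] the distance of a node to [x] is at most
    [|(k+1)/n - x| + om / (4m)]. The mean of the first summand is at most
    [1 / sqrt n], so the gaps average to at most
    [1/n + (om / sqrt n + om^2 / (4m)) / m], which is a perfect square. *)
Lemma node_gap_le (R : realType) (N : nat) (w : nat -> R) (m om x : R) :
  0 < m -> (forall i, (i <= N.+1)%N -> m <= w i) ->
  (forall i, (i <= N)%N -> `|w i - w i.+1| <= om) -> 0 <= x <= 1 ->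
  weighted_poly N.+1 (fun k => (node N.+2 w k.+1 - node N.+2 w k) * w k) x <=
  weighted_poly N.+1 w x * (1 / Num.sqrt N.+2%:R + 1 / (2 * m) * om) ^+ 2.
Proof.
move=> m0 mw wom x01.
have w0 i : (i <= N.+1)%N -> 0 < w i by move=> /mw; apply: lt_le_trans.
have om0 : 0 <= om by apply: le_trans (wom 0%N isT).
have := weighted_poly_node_gap x w0.
set G := weighted_poly _ (fun k => _ * w k) x; set Q := weighted_poly _ w x.
set A := weighted_poly N _ x; set n : R := N.+2%:R => GE.
have n0 : 0 < n by rewrite ltr0n.
have mQ : m <= Q by apply: weighted_poly_ge.
set r := 1 / Num.sqrt n.
have r0 : 0 < r by rewrite divr_gt0 // sqrtr_gt0.
have rr : r ^+ 2 = n^-1 by rewrite /r div1r exprVn sqr_sqrtr // ltW.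
have AB : A <= om * r + om ^+ 2 / (4 * m).
  apply: (@le_trans _ _ (weighted_poly N
     (fun k => om * `|k.+1%:R / n - x| + om ^+ 2 / (4 * m) * 1) x)).
    apply: ler_weighted_poly => // k kN.
    rewrite (le_trans (ler_norm _)) // normrM.
    have := wom k kN; have := node_dist_equispaced_le m0 mw wom kN.
    rewrite -/n; set s := node _ _ _; set d := `|w k - _| => sd dom.
    apply: (@le_trans _ _ (om * `|s - x|)); first by rewrite ler_wpM2r.
    have -> : om * `|k.+1%:R / n - x| + om ^+ 2 / (4 * m) * 1 =
      om * (`|k.+1%:R / n - x| + om / (4 * m)) by ring.
    rewrite ler_wpM2l // [leRHS]addrC.
    have -> : s - x = (s - k.+1%:R / n) + (k.+1%:R / n - x) by ring.
    by rewrite (le_trans (ler_normD _ _)) // lerD2r.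
  rewrite weighted_polyD !weighted_polyZ weighted_poly1 mulr1 lerD2r ler_wpM2l //.
  apply: (le_trans (weighted_poly_abs_le_sqrt N _ x01)).
  rewrite -[r]gtr0_norm // -sqrtr_sqr ler_wsqrtr // rr.
  exact: weighted_poly_shifted_moment2.
set B := om * r + _ in AB.
have B0 : 0 <= B.
  by rewrite addr_ge0 ?mulr_ge0 // ?invr_ge0 ?mulr_ge0 ?exprn_ge0 // ltW.
have GB : n * G <= Q + n * B.
  rewrite GE lerD2l (le_trans (ler_wpM2l _ AB)) // ler_wpM2r //.
  by rewrite ler_nat.
(* the perfect square: 1/n, the cross term and om^2/(4m^2) *)
have -> : Q * (r + 1 / (2 * m) * om) ^+ 2 = Q / n + Q / m * B.
  by rewrite -rr /B; field; rewrite gt_eqF.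
have Bm : B <= Q / m * B by rewrite ler_peMl // ler_pdivlMr // mul1r.
apply: le_trans (_ : Q / n + B <= _); last by rewrite lerD2l.
by rewrite -(ler_pM2l n0) mulrDr mulrCA divff ?gt_eqF // mulr1.
Qed.

Theorem theorem16 (R : realType) (n : nat) (hn : (2 <= n)%N)
    (phi : R -> R) (phi_cont : {within `[0, 1], continuous phi})
    (phi_gt0 : forall x : R, x \in `[0, 1] -> 0 < phi x)
    (m : R) (m_value : (phi @` `[0, 1]) m) (m_lower : lbound (phi @` `[0, 1]) m)
    (hW : propertyW n (bernstein_weight n.-1 phi))
    (f : R -> R) (f_cont : {within `[0, 1], continuous f})
    (x : R) (hx : x \in `[0, 1]) :
  `|rational_bernstein n (bernstein_weight n.-1 phi) f x - f x| <=
    (1 + Num.sqrt (x * (1 - x))) *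
    omega1 f (1 / Num.sqrt n%:R
              + 1 / (2 * m) * omega1 phi (1 / (n%:R - 1))).
Proof.
case: n hn hW => [|[|N]] // _ _.
set w := bernstein_weight _ phi; set om := omega1 phi _; set h := _ + _ * om.
have m0 : 0 < m by case: m_value => t t01 <-; apply: phi_gt0; rewrite inE.
have x01 : 0 <= x <= 1 by move: hx; rewrite in_itv.
have /andP[x0 x1] := x01.
have N0 : 0 < N.+1%:R :> R by rewrite ltr0n.
have knot i : (i <= N.+1)%N -> (i%:R / N.+1%:R : R) \in `[0, 1].
  by move=> iN; rewrite in_itv /= divr_ge0 //= ler_pdivrMr // mul1r ler_nat.
have mw i : (i <= N.+1)%N -> m <= w i.
  move=> /knot iN; apply: m_lower; exists (i%:R / N.+1%:R) => //.
have w0 i : (i <= N.+1)%N -> 0 < w i by move=> /mw; apply: lt_le_trans.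
have wom i : (i <= N)%N -> `|w i - w i.+1| <= om.
  move=> iN; apply: omega1_ge => //; [exact/knot/leqW|exact: knot|].
  have -> : i%:R / N.+1%:R - i.+1%:R / N.+1%:R = - N.+1%:R^-1 :> R.
    by rewrite -[i.+1%:R]natr1; ring.
  rewrite normrN gtr0_norm ?invr_gt0 // div1r.
  by rewrite -[N.+2%:R]natr1 addrK.
have om0 : 0 <= om by apply: le_trans (wom 0%N isT).
have h0 : 0 < h.
  apply: ltr_pwDl; first by rewrite divr_gt0 // sqrtr_gt0 ltr0n.
  by rewrite mulr_ge0 // divr_ge0 // mulr_ge0 // ltW.
set Q := weighted_poly N.+1 w x.
have Q0 : 0 < Q by apply: (lt_le_trans m0); apply: weighted_poly_ge.
pose s := node N.+2 w.
(* the operator is the mean over the nodes for the probability weights p *)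
pose p (k : 'I_N.+3) := (gamma N.+1 w k + gamma_pred N.+1 w k) *
  (x ^+ k * (1 - x) ^+ (N.+2 - k)) / Q.
have p0 k : 0 <= p k.
  by rewrite /p !mulr_ge0 ?exprn_ge0 ?subr_ge0 ?invr_ge0 ?(ltW Q0) //
    ltW // gamma_sum_gt0 // leq_ord.
have p1 : \sum_k p k = 1.
  by rewrite -mulr_suml sum_gamma_elevation divff // gt_eqF.
have var : \sum_k p k * (s k - x) ^+ 2 <= x * (1 - x) * h ^+ 2.
  under eq_bigr do rewrite /p mulrAC.
  rewrite -mulr_suml sum_node_deviation_sqr // ler_pdivrMr // -[leRHS]mulrA.
  rewrite ler_wpM2l ?mulr_ge0 ?subr_ge0 // [leRHS]mulrC.
  exact: node_gap_le.
have s01 (j : 'I_N.+3) : s j \in `[0, 1].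
  by apply: node_itv => //; exact: leq_ord.
have -> : rational_bernstein N.+2 w f x - f x = \sum_k p k * (f (s k) - f x).
  under [RHS]eq_bigr do rewrite mulrBr.
  rewrite sumrB -mulr_suml p1 mul1r; congr (_ - _).
  by apply: eq_bigr => k _; rewrite /p /= -/s -/Q; ring.
set om_f := omega1 f h.
have omf0 : 0 <= om_f by apply: omega1_ge0 => //; exact: ltW.
apply: (le_trans (ler_norm_sum _ _ _)).
apply: (@le_trans _ _ (\sum_k (p k + p k * `|s k - x| / h) * om_f)).
  apply: ler_sum => k _; rewrite normrM ger0_norm //.
  apply: (le_trans (ler_wpM2l (p0 k) (dist_le_omega1 f_cont h0 (s01 k) hx))).
  by rewrite mulrA mulrDr mulr1 mulrA.
rewrite -mulr_suml ler_wpM2r // big_split /= p1 lerD2l -mulr_suml ler_pdivrMr //.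
apply: (le_trans (mean_abs_le_sqrt (fun k : 'I_N.+3 => s k - x) p0 p1)).
rewrite -[h in leRHS]gtr0_norm // -sqrtr_sqr -sqrtrM ?mulr_ge0 ?subr_ge0 //.
exact: ler_wsqrtr.
Qed.
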